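(* Let $\mathcal{S}$ be the family consisting of the spaces $\ell^\infty$, $c_0$, $\ell^p$ for $0<p<+\infty$, and $\bigcap_{p>a}\ell^p$ for $0\le a<+\infty$. Let $X,Y\in\mathcal{S}$ with $X\subset Y$ and $X\neq Y$. Then there is spaceability for the couple $(Y,X)$; that is, there exists an infinite dimensional vector subspace $F$ of $Y$, closed in $Y$, such that $F\setminus\{0\}\subset Y\setminus X$.
   Context: All spaces are spaces of complex sequences $f=(f(n))_{n\ge1}$, with their natural complete metrizable vector space topologies: $\ell^\infty$ and $c_0$ carry the sup norm; $\ell^p$ for $1\le p<\infty$ carries the norm $\|f\|_p=(\sum_n|f(n)|^p)^{1/p}$; $\ell^p$ for $0<p<1$ carries the metric $d_p(f,g)=\sum_n|f(n)-g(n)|^p$; and $\bigcap_{p>a}\ell^p$ (intersection over all finite $p>a$) carries the metrizable topology in which $f_m\to f$ iff $f_m\to f$ in $\ell^p$ for every $p\in(a,+\infty)$. *)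

(* Defs.v *)
From HB Require Import structures.
From mathcomp Require Import all_boot all_order all_algebra.
From mathcomp Require Import complex.
From mathcomp Require Import all_classical all_reals all_analysis.

Set Implicit Arguments.
Unset Strict Implicit.
Unset Printing Implicit Defensive.

Import Order.TTheory GRing.Theory Num.Theory.
Import numFieldNormedType.Exports.

Local Open Scope classical_set_scope.
Local Open Scope ring_scope.

(* Sequences are indexed from 0: the n-th entry here is f(n+1) of a sequence
   indexed by n >= 1.  The ^o makes R[i] a module over itself, hence [cseq R]
   an R[i]-module. *)
Definition cseq (R : realType) := nat -> R[i]^o.

Definition modulus (R : realType) (z : R[i]) : R := Normc.normc z.

Definition sum_pow (R : realType) (p : R) (f : cseq R) : \bar R :=
  (\sum_(0 <= n <oo) ((modulus (f n)) `^ p)%:E)%E.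

Definition sup_modulus (R : realType) (f : cseq R) : \bar R :=
  ereal_sup (range (fun n => (modulus (f n))%:E)).

(* The translation-invariant distance of l^p, for p in ]0, +oo]: the norm
   distance if p >= 1 (p = +oo included), the p-th power sum if p < 1.  It is
   +oo when f - g is not in l^p. The value at p = -oo is never used. *)
Definition lp_dist (R : realType) (p : \bar R) (f g : cseq R) : \bar R :=
  match p with
  | (p%:E)%E => if 1 <= p then poweR (sum_pow p (f - g)) p^-1
                else sum_pow p (f - g)
  | _ => sup_modulus (f - g)
  end.

Inductive seq_space (R : realType) : Type :=
  | Linfty
  | Czero
  | Lp (p : R) of 0 < p
  | Lcap (a : R) of 0 <= a.

Definition carrier (R : realType) (X : seq_space R) : set (cseq R) :=
  match X with
  | Linfty => [set f | (sup_modulus f < +oo)%E]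
  | Czero => [set f | f n @[n --> \oo] --> (0 : R[i]^o)]
  | @Lp _ p _ => [set f | (sum_pow p f < +oo)%E]
  | @Lcap _ a _ =>
      \bigcap_(p in [set p : R | a < p]) [set f | (sum_pow p f < +oo)%E]
  end.

(* The exponents p whose distances [lp_dist p] generate the topology. *)
Definition exponents (R : realType) (X : seq_space R) : set (\bar R) :=
  match X with
  | Linfty | Czero => [set +oo%E]
  | @Lp _ p _ => [set p%:E]
  | @Lcap _ a _ => [set p%:E | p in [set p : R | a < p]]
  end.

Definition space (R : realType) (X : seq_space R) : Type :=
  set_type (carrier X).

HB.instance Definition _ (R : realType) (X : seq_space R) :=
  Choice.copy (space X) (set_type (carrier X)).

Definition elt (R : realType) (X : seq_space R) (f : space X) : cseq R :=
  \val f.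

Definition basic_ball (R : realType) (X : seq_space R) (s : seq (\bar R))
    (e : R) (f : space X) : set (space X) :=
  [set g | forall p, p \in s -> (lp_dist p (elt f) (elt g) < e%:E)%E].

(* Metric topology for l^oo, c_0 and l^p (there all balls of s are the same,
   since [exponents X] is a singleton); for the intersection over p > a, the
   coarsest topology making all inclusions into l^p, p > a, continuous, i.e.
   the one of simultaneous convergence in every l^p, p > a. *)
Definition space_open (R : realType) (X : seq_space R) : set_system (space X) :=
  [set A | forall f, A f -> exists (s : seq (\bar R)) (e : R),
     [/\ [set` s] `<=` exponents X, 0 < e & basic_ball s e f `<=` A]].

Section SpaceTopology.
Context (R : realType) (X : seq_space R).

Lemma space_openT : space_open (X := X) setT.
Proof.
move=> f _; exists [::], 1; split => //.
Qed.

Lemma space_openI : setI_closed (space_open (X := X)).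
Proof.
move=> A B oA oB f [Af Bf].
have [s [e [sX e0 sA]]] := oA f Af.
have [t [d [tX d0 tB]]] := oB f Bf.
exists (s ++ t), (Num.min e d); split.
- by move=> p /=; rewrite mem_cat => /orP[/sX|/tX].
- by rewrite lt_min e0.
- move=> g gst; split.
  + apply: sA => p ps; apply: lt_le_trans (gst p _) _.
      by rewrite mem_cat ps.
    by rewrite lee_fin ge_min lexx.
  + apply: tB => p pt; apply: lt_le_trans (gst p _) _.
      by rewrite mem_cat pt orbT.
    by rewrite lee_fin ge_min lexx orbT.
Qed.

Lemma space_open_bigU (I : Type) (A : I -> set (space X)) :
  (forall i, space_open (A i)) -> space_open (\bigcup_i A i).
Proof.
move=> oA f [i _ Af]; have [s [e [sX e0 sA]]] := oA i f Af.
by exists s, e; split => // g /sA; exists i.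
Qed.

HB.instance Definition _ := @isOpenTopological.Build (space X)
  (space_open (X := X)) space_openT space_openI space_open_bigU.

End SpaceTopology.

Definition vector_subspace (R : realType) (F : set (cseq R)) : Prop :=
  GRing.submod_closed [in F].

Definition finitely_generated (R : realType) (F : set (cseq R)) : Prop :=
  exists (k : nat) (e : 'I_k -> cseq R),
    (forall i, F (e i)) /\
    (forall f, F f -> exists c : 'I_k -> R[i], f = \sum_(i < k) c i *: e i).

Definition closed_in (R : realType) (Y : seq_space R) (F : set (cseq R)) : Prop :=
  closed (@elt R Y @^-1` F).

Definition spaceable (R : realType) (Y X : seq_space R) : Prop :=
  exists F : set (cseq R),
    [/\ F `<=` carrier Y,
        vector_subspace F,
        ~ finitely_generated F,
        closed_in Y F &
        F `\ 0 `<=` carrier Y `\` carrier X].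

(* Main.v *)
(** If [f] lies in [Y] but not in [X], split the indices into infinitely many
    infinite blocks [{block k m | m}] and let [F] consist of the [h] in [Y]
    whose restriction to each block is proportional to [f].  All the spaces are
    invariant under extension by zero and under passing to subsequences:
    hence [F] contains a copy of [f] on each block, and a nonzero [h] in
    [F] lying in [X] would force [f] into [X].  [F] is closed because
    convergence in [Y] implies pointwise convergence. *)
Require Import Defs.
From mathcomp Require Import all_boot all_order all_algebra.
From mathcomp Require Import complex.
From mathcomp Require Import all_classical all_reals all_analysis.

Set Implicit Arguments.
Unset Strict Implicit.
Unset Printing Implicit Defensive.

Import Order.TTheory GRing.Theory Num.Theory.
Import numFieldNormedType.Exports.

Local Open Scope classical_set_scope.
Local Open Scope ring_scope.

(** * Partition of the indices [n] by the power of 2 that divides [n.+1] *)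

Definition block (k m : nat) : nat := (2 ^ k * m.*2.+1).-1.

Lemma block_succ k m : (block k m).+1 = (2 ^ k * m.*2.+1)%N.
Proof. by rewrite prednK// muln_gt0 expn_gt0. Qed.

Lemma block_mono k : {mono block k : m n / (m <= n)%N}.
Proof.
by move=> m n; rewrite -ltnS !block_succ leq_pmul2l ?expn_gt0// ltnS leq_double.
Qed.

(** An index determines its block number, so distinct blocks are disjoint. *)
Lemma logn_block k m : logn 2 (block k m).+1 = k.
Proof.
rewrite block_succ lognM ?expn_gt0// pfactorK// lognE/= dvdn2/= odd_double/=.
by rewrite addn0.
Qed.

Lemma block_surj n : exists k m, n = block k m.
Proof.
have [q q2 nE] := @pfactor_coprime 2 n.+1 isT isT.
exists (logn 2 n.+1), q./2; apply: succn_inj; rewrite block_succ mulnC.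
rewrite {1}nE; congr (_ * _)%N; rewrite coprime2n in q2.
by rewrite -{1}(odd_double_half q) q2.
Qed.

Section Sequences.
Context (R : realType).
Implicit Types (f g h : cseq R) (phi : nat -> nat) (p : R) (X Y : seq_space R).

(** * The modulus, and extension by zero along an increasing map *)

Lemma modulus_ge0 (z : R[i]) : 0 <= modulus z.
Proof. by case: z => a b; rewrite sqrtr_ge0. Qed.

Lemma modulusD (z w : R[i]) : modulus (z + w) <= modulus z + modulus w.
Proof. exact: le_normcD. Qed.

Lemma modulusN (z : R[i]) : modulus (- z) = modulus z.
Proof. exact: normcN. Qed.

Lemma modulusM (z w : R[i]) : modulus (z * w) = modulus z * modulus w.
Proof. exact: Normc.normcM. Qed.

Lemma modulus0 : modulus (0 : R[i]) = 0.
Proof. exact: Normc.normc0. Qed.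

Lemma modulus_eq0 (z : R[i]) : modulus z = 0 -> z = 0.
Proof. exact: Normc.eq0_normc. Qed.

(* [spread phi f] moves [f m] to position [phi m] and is [0] off the range
   of [phi], provided that [phi] is increasing. *)
Definition spread phi f : cseq R :=
  fun n => \sum_(m < n.+1 | phi m == n) f m.

(** This is why the finite range [m < n.+1] in [spread] suffices: any [m] with [phi m = n] is at
    most [n]. *)
Lemma leq_mono_id phi n : {mono phi : m n / (m <= n)%N} -> (n <= phi n)%N.
Proof.
move=> mphi; elim: n => // n IH; apply: (leq_ltn_trans IH).
by rewrite (leqW_mono mphi).
Qed.

Lemma spreadE phi f m :
  {mono phi : m n / (m <= n)%N} -> spread phi f (phi m) = f m.
Proof.
move=> mphi; have lt_m : (m < (phi m).+1)%N by rewrite ltnS leq_mono_id.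
rewrite /spread (big_pred1 (Ordinal lt_m))// => i.
by rewrite /= (inj_eq (incn_inj mphi)).
Qed.

Lemma spread_out phi f n : (forall m, phi m <> n) -> spread phi f n = 0.
Proof. by move=> nphi; rewrite /spread big_pred0// => i; apply/eqP/nphi. Qed.

Lemma spread_block k l m f :
  spread (block k) f (block l m) = if k == l then f m else 0.
Proof.
case: eqVneq => [<-|kl]; first exact: spreadE (@block_mono k).
apply: spread_out => n /(congr1 (fun n => logn 2 n.+1)).
by rewrite !logn_block => /eqP; rewrite (negbTE kl).
Qed.

(** * Power sums and suprema *)

Lemma sum_powE p f :
  sum_pow p f = (\esum_(n in [set: nat]) (modulus (f n) `^ p)%:E)%E.
Proof. by rewrite -nneseries_esumT// => n; rewrite lee_fin powR_ge0. Qed.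

Lemma sum_pow_comp phi p f :
  injective phi -> (sum_pow p (f \o phi) <= sum_pow p f)%E.
Proof.
move=> iphi; rewrite !sum_powE.
rewrite -(@reindex_esum R nat nat setT (range phi) phi
  (fun n => (modulus (f n) `^ p)%:E)); last first.
  by split => // m n _ _ /iphi.
rewrite esum_mkcond; apply: le_esum => n _.
by case: ifP => // _; rewrite lee_fin powR_ge0.
Qed.

Lemma sum_pow_spread phi p f : p != 0 -> {mono phi : m n / (m <= n)%N} ->
  sum_pow p (spread phi f) = sum_pow p f.
Proof.
move=> p0 mphi; rewrite !sum_powE.
transitivity (\esum_(n in range phi) (modulus (spread phi f n) `^ p)%:E)%E.
  rewrite [RHS]esum_mkcond; apply: eq_esum => n _.
  (* Off the range the entry is 0 and contributes 0 because [p != 0]; 0 to the power 0 would be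
     1. *)
  case: ifPn => // /negP nphi; rewrite spread_out ?modulus0 ?powR0//.
  by move=> m mn; apply: nphi; rewrite inE; exists m.
rewrite (@reindex_esum R nat nat setT (range phi) phi); last first.
  by split => // m n _ _ /(incn_inj mphi).
by apply: eq_esum => m _; rewrite spreadE.
Qed.

(** A substitute for the triangle inequality that also covers p < 1: the sum is at most twice the
    larger term. *)
Lemma powRD_le p (x y : R) : 0 < p -> 0 <= x -> 0 <= y ->
  (x + y) `^ p <= 2 `^ p * (x `^ p + y `^ p).
Proof.
move=> p0 x0 y0; wlog xy : x y x0 y0 / x <= y.
  move=> W; have [/W->//|/ltW/W] := leP x y.
  by rewrite addrC [X in _ * X]addrC; apply.
apply: (@le_trans _ _ ((2 * y) `^ p)).
  apply: ge0_ler_powR; rewrite ?nnegrE ?(ltW p0) ?addr_ge0 ?mulr_ge0//.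
  by rewrite mulr_natl mulr2n lerD2r.
by rewrite powRM// ler_pM2l ?powR_gt0// lerDr powR_ge0.
Qed.

Lemma sum_pow_linear_lty p (a : R[i]) f g : 0 < p ->
  (sum_pow p f < +oo)%E -> (sum_pow p g < +oo)%E ->
  (sum_pow p (a *: f + g)%R < +oo)%E.
Proof.
move=> p0 ffin gfin; have pge0 x : (0 <= (x `^ p)%:E)%E.
  by rewrite lee_fin powR_ge0.
have bound n : ((modulus ((a *: f + g)%R n) `^ p)%:E <=
    ((2 * modulus a) `^ p)%:E * (modulus (f n) `^ p)%:E +
    (2 `^ p)%:E * (modulus (g n) `^ p)%:E)%E.
  rewrite -!EFinM -EFinD lee_fin powRM ?modulus_ge0// -mulrA -mulrDr.
  rewrite -powRM ?modulus_ge0// -modulusM.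
  apply: le_trans (powRD_le p0 (modulus_ge0 _) (modulus_ge0 _)).
  apply: ge0_ler_powR; rewrite ?nnegrE ?(ltW p0) ?addr_ge0 ?modulus_ge0//.
  exact: modulusD.
apply: le_lt_trans (lee_nneseries _ (fun n _ => bound n)) _ => //.
rewrite nneseriesD; [|by move=> *; rewrite mule_ge0..].
rewrite !nneseriesZl//; apply: lte_add_pinfty.
  by apply: lte_mul_pinfty.
by apply: lte_mul_pinfty.
Qed.

Lemma sum_pow_term p f n : ((modulus (f n) `^ p)%:E <= sum_pow p f)%E.
Proof.
have pge0 m : (0 <= (modulus (f m) `^ p)%:E)%E by rewrite lee_fin powR_ge0.
apply: le_trans (@nneseries_lim_ge R _ xpredT 0 n.+1 (fun m _ _ => pge0 m)).
by rewrite big_nat_recr//= leeDr// sume_ge0.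
Qed.

Lemma sup_modulus_term f n : ((modulus (f n))%:E <= sup_modulus f)%E.
Proof. by apply: ereal_sup_ubound; exists n. Qed.

Lemma sup_modulus_ltyP f :
  (sup_modulus f < +oo)%E <-> exists M : R, forall n, modulus (f n) <= M.
Proof.
split=> [|[M fM]]; last first.
  apply: (@le_lt_trans _ _ M%:E); last by rewrite ltry.
  by apply: ge_ereal_sup => _ [n _ <-]; rewrite lee_fin.
have := sup_modulus_term f; case: (sup_modulus f) => [M| |]//= fM _.
  by exists M => n; rewrite -lee_fin.
by have := fM 0%N; rewrite leeNy_eq.
Qed.

(** * Stability of the spaces under linear combinations, subsequences and extension by zero *)

Lemma carrier_linear X (a : R[i]) f g :
  carrier X f -> carrier X g -> carrier X (a *: f + g).
Proof.
case: X => [||p p0|b b0] /=.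
- move=> /sup_modulus_ltyP[M fM] /sup_modulus_ltyP[N gN].
  apply/sup_modulus_ltyP; exists (modulus a * M + N) => n.
  apply: le_trans (modulusD _ _) _; rewrite lerD//.
  by rewrite modulusM ler_wpM2l// modulus_ge0.
- move=> f0 g0; rewrite -[X in _ --> X](addr0 0) -{1}(scaler0 _ a).
  by apply: cvgD g0; apply: cvgZr.
- exact: sum_pow_linear_lty.
- move=> fb gb p bp; apply: sum_pow_linear_lty (fb p bp) (gb p bp).
  exact: le_lt_trans bp.
Qed.

Lemma carrier0 X : carrier X (0 : cseq R).
Proof.
have sum0 p : 0 < p -> (sum_pow p (0 : cseq R)%R < +oo)%E.
  move=> p0; rewrite sum_powE esum1 ?ltry// => n _.
  by rewrite modulus0 powR0// gt_eqF.
case: X => [||p p0|b b0] /=.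
- by apply/sup_modulus_ltyP; exists 0 => n; rewrite modulus0.
- exact: cvg_cst.
- exact: sum0.
- by move=> p bp; apply: sum0; exact: le_lt_trans bp.
Qed.

Lemma carrier_comp X phi f : {mono phi : m n / (m <= n)%N} ->
  carrier X f -> carrier X (f \o phi).
Proof.
move=> mphi; have iphi := incn_inj mphi.
case: X => [||p p0|b b0] /=.
- move=> /sup_modulus_ltyP[M fM]; apply/sup_modulus_ltyP.
  by exists M => n; exact: fM.
- move=> f0; apply: cvg_comp f0; apply/cvgnyPge => N.
  by exists N => // n /= Nn; exact: leq_trans (leq_mono_id _ mphi).
- exact/le_lt_trans/sum_pow_comp.
- move=> fb p bp; apply: le_lt_trans (fb p bp); exact: sum_pow_comp.
Qed.

Lemma carrier_spread X phi f : {mono phi : m n / (m <= n)%N} ->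
  carrier X f -> carrier X (spread phi f).
Proof.
move=> mphi.
have spreadP n : (exists2 m, n = phi m & spread phi f n = f m) \/
    spread phi f n = 0.
  have [[m <-]|nphi] := pselect (exists m, phi m = n).
    by left; exists m; rewrite ?spreadE.
  by right; apply: spread_out => m mn; apply: nphi; exists m.
case: X => [||p p0|b b0] /=.
- move=> /sup_modulus_ltyP[M fM]; apply/sup_modulus_ltyP; exists M => n.
  have [[m _ ->//]|->] := spreadP n.
  by rewrite modulus0; exact: le_trans (modulus_ge0 _) (fM 0%N).
- move=> /cvgr0Pnorm_lt f0; apply/cvgr0Pnorm_lt => e e0.
  (* An index [phi m] beyond [phi N] has [m] beyond [N], as [phi] reflects the order. *)
  have [N _ fN] := f0 e e0; exists (phi N) => // n /= phiNn.
  have [[m nE ->]|->] := spreadP n; last by rewrite normr0.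
  by apply: fN; rewrite /= -mphi -nE.
- by rewrite sum_pow_spread// gt_eqF.
- move=> fb p bp; rewrite /= sum_pow_spread//; first exact: fb.
  by rewrite gt_eqF//; exact: le_lt_trans bp.
Qed.

(** * Pointwise control by the distances, and closedness *)

Lemma exponent_exists Y :
  exists2 p, exponents Y p & p = +oo%E \/ exists2 r : R, 0 < r & p = r%:E.
Proof.
case: Y => [||p p0|b b0] /=; [by exists +oo%E => //; left..| |].
  by exists p%:E => //; right; exists p.
have b1 : b < b + 1 by rewrite ltrDl.
exists (b + 1)%:E; first by exists (b + 1).
by right; exists (b + 1) => //; exact: le_lt_trans b1.
Qed.

(** A single term is at most the supremum or the whole sum. The radius is [d] itself when the
    distance is a norm, and [d] to the power [r] when [r < 1], where no root is taken. *)
Lemma lp_dist_pointwise (p : \bar R) (d : R) : 0 < d ->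
  p = +oo%E \/ (exists2 r : R, 0 < r & p = r%:E) ->
  exists2 e : R, 0 < e & forall f g, (lp_dist p f g < e%:E)%E ->
    forall n, modulus ((f - g) n) < d.
Proof.
move=> d0 [->|[r r0 ->]].
  exists d => // f g fg n; rewrite -lte_fin.
  exact: le_lt_trans (sup_modulus_term _ _) fg.
rewrite /lp_dist /=; case: (1 <= r).
  exists d => // f g fg n; rewrite -lte_fin; apply: le_lt_trans fg.
  (* The modulus is written as the [r^-1]-th power of its [r]-th power, to compare with the norm. *)
  rewrite -(powRr1 (modulus_ge0 ((f - g) n))) -(@mulfV _ r) ?gt_eqF// powRrM.
  rewrite -poweR_EFin; apply: gt0_ler_poweR (sum_pow_term _ _ _).
  - by rewrite invr_ge0 ltW.
  - by rewrite in_itv/= lee_fin powR_ge0 leey.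
  - rewrite in_itv/= leey andbT; apply: le_trans (sum_pow_term _ _ 0%N).
    by rewrite lee_fin powR_ge0.
exists (d `^ r); first exact: powR_gt0.
move=> f g fg n; rewrite ltNge; apply/negP => dn.
have := le_lt_trans (sum_pow_term r (f - g) n) fg.
rewrite lte_fin ltNge ge0_ler_powR ?nnegrE ?modulus_ge0// ltW//.
Qed.

Lemma closed_pointwise_linear Y (i j : nat) (a b : R[i]) :
  closed_in Y [set h | h i * a = h j * b].
Proof.
rewrite /closed_in -openC.
change (space_open (~` (@elt R Y @^-1` [set h | h i * a = h j * b]))).
move=> h /= nh.
set c := elt h i * a - elt h j * b.
have c0 : 0 < modulus c.
  rewrite lt_neqAle modulus_ge0 andbT eq_sym; apply/eqP => /modulus_eq0/eqP.
  by rewrite subr_eq0 => /eqP.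
(* The radius will force entries of [h - g] below [modulus c / M]; the [+ 1] makes [M] positive and
   the final inequality strict. *)
pose M := modulus a + modulus b + 1.
have M0 : 0 < M by rewrite ltr_wpDl// addr_ge0// modulus_ge0.
have [p Yp pE] := exponent_exists Y.
have [e e0 eP] := lp_dist_pointwise (divr_gt0 c0 M0) pE.
exists [:: p], e; split => //.
  by move=> q /=; rewrite inE => /eqP->.
move=> g /(_ p); rewrite inE eqxx => /(_ isT)/eP gP /= gE.
(* By [gE] the defect of [g] vanishes, so [c] is the defect of [h - g], which is too small. *)
have cE : c = (elt h - elt g) i * a - (elt h - elt g) j * b.
  by rewrite /c !fctE !mulrBl gE opprB addrA subrK.
have : modulus c < modulus c; last by rewrite ltxx.
apply: (@le_lt_trans _ _
  (modulus c / M * modulus a + modulus c / M * modulus b)).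
  rewrite {1}cE; apply: le_trans (modulusD _ _) _.
  rewrite modulusN !modulusM.
  by rewrite lerD// ler_wpM2r ?modulus_ge0// ltW.
by rewrite -mulrDr mulrAC ltr_pdivrMr// ltr_pM2l// ltrDl.
Qed.

(** * Infinite dimension *)

Lemma not_finitely_generated (F : set (cseq R)) (u : nat -> cseq R)
    (x : nat -> nat) (a : R[i]) :
  a != 0 -> (forall k, F (u k)) ->
  (forall k l, u k (x l) = if k == l then a else 0) -> ~ finitely_generated F.
Proof.
move=> a0 Fu uE [n [e [_ eP]]].
have {}eP k := cid (eP _ (Fu k)).
(* Rank argument: the values of [n.+1] of the [u k] at the points [x l] form [a] times the identity,
   of rank [n.+1], yet this matrix factors through the [n] generators. *)
pose C := \matrix_(k < n.+1, i < n) projT1 (eP k) i.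
pose E := \matrix_(i < n, l < n.+1) (e i (x l) : R[i]).
have CE : C *m E = a%:M.
  apply/matrixP => k l; rewrite !mxE -val_eqE mulrb.
  rewrite -(uE k l) (projT2 (eP k)) fct_sumE.
  by apply: eq_bigr => i _; rewrite !mxE.
have := mxrankM_maxl C E.
rewrite CE -scalemx1 mxrank_scale_nz// mxrank1.
by move=> /leq_trans/(_ (rank_leq_col C)); rewrite ltnn.
Qed.

End Sequences.

(** * Construction of the subspace *)

Theorem theorem7 (R : realType) (X Y : seq_space R) :
  carrier X `<=` carrier Y -> carrier X <> carrier Y -> spaceable Y X.
Proof.
move=> XY XneY.
have [f Yf nXf] : exists2 f, carrier Y f & ~ carrier X f.
  apply: contrapT => nf; apply: XneY; apply/seteqP; split => // f Yf.
  by apply: contrapT => nXf; apply: nf; exists f.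
have [m0 fm0] : exists m0, f m0 != 0.
  apply: contrapT => nf; apply: nXf.
  rewrite (_ : f = 0); first exact: carrier0.
  apply/funext => m; apply/eqP; apply: contrapT => /negP fm.
  by apply: nf; exists m.
(* Proportionality to [f] on a block, cross-multiplied against the nonzero entry [f m0]: each
   condition is linear in [h] and involves two coordinates, hence is closed. *)
pose proportional_at km : set (cseq R) :=
  [set h | h (block km.1 km.2) * f m0 = h (block km.1 m0) * f km.2].
pose proportional := \bigcap_(km in [set: nat * nat]) proportional_at km.
exists (carrier Y `&` proportional); split.
- by move=> h [].
- split.
    rewrite inE; split; first exact: carrier0.
    by move=> km _; rewrite /proportional_at /= !mul0r.
  move=> a g h; rewrite !inE => -[Yg gP] [Yh hP]; split.
    exact: carrier_linear.
  move=> km _; rewrite /proportional_at /= !fctE !mulrDl -!scalerAl.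
  by rewrite (gP km I) (hP km I).
- apply: (@not_finitely_generated _ _ (fun k => spread (block k) f)
    (fun l => block l m0) (f m0)) => //.
    move=> k; split; first exact: carrier_spread (@block_mono k) Yf.
    move=> [l m] _; rewrite /proportional_at /= !spread_block.
    by case: eqP => _; rewrite ?mul0r// mulrC.
  by move=> k l; rewrite spread_block.
- rewrite /closed_in (_ : _ @^-1` _ = \bigcap_(km in [set: nat * nat])
    (@elt R Y @^-1` proportional_at km)).
    by apply: closed_bigI => km _; exact: closed_pointwise_linear.
  apply/seteqP; split => h /=; first by case.
  by move=> hP; split => //; exact: set_valP.
- move=> h [[Yh propE] /= h0]; split => // Xh; apply: nXf.
  have hP k m : h (block k m) * f m0 = h (block k m0) * f m := propE (k, m) I.
  (* If all these entries vanished, proportionality would make [h] zero on every block. *)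
  have [k hk] : exists k, h (block k m0) != 0.
    apply: contrapT => nh; apply: h0; apply/funext => n.
    have [k [m ->]] := block_surj n.
    have /eqP hk0 : h (block k m0) == 0.
      by apply: contrapT => /negP hk; apply: nh; exists k.
    have /eqP := hP k m; rewrite hk0 mul0r mulf_eq0 (negbTE fm0) orbF.
    by move=> /eqP.
  (* On block [k] the proportionality factor is invertible, so [f] is recovered from [h]; [+ 0] fits
     the form of [carrier_linear]. *)
  rewrite (_ : f = (f m0 / h (block k m0)) *: (h \o block k) + 0).
    apply: carrier_linear (carrier0 X).
    exact: carrier_comp (@block_mono k) Xh.
  apply/funext => m; rewrite addr0.
  change (f m = f m0 / h (block k m0) * h (block k m)).
  apply: (mulfI hk); rewrite -hP [RHS]mulrA.
  by rewrite (mulrCA (h _)) divff// mulr1 mulrC.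
Qed.
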